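(* Let $k,l,m\ge 0$ be integers, at most one of which is zero. The Theta graph $H=\theta(k,l,m)$ is not $M'$-contractible if and only if exactly one of $k,l,m$ is odd and $H$ is triangle-free.
   Context: All graphs are finite and simple (no loops or multiple edges). For integers $k,l,m\ge 0$, at most one of which is zero, the Theta graph $\theta(k,l,m)$ is the $(2+k+l+m)$-vertex graph obtained by connecting two vertices $x,y$ by three internally disjoint paths which contain $k,l,m$ internal vertices, respectively. For a graph $H$, $M'(H)$ is the graph that contains two vertices $v_1,v_2$ for every $v\in V(H)$, and in which $u_i$ is adjacent to $v_j$ exactly when $uv\in E(H)$ and ($i=2$ or $j=2$ or both). $H$ is $M'$-contractible if $M'(H)$ contains a rooted $H$-minor where $v_1$ is the root corresponding to $v\in V(H)$; that is, there are pairwise vertex-disjoint connected subgraphs $C_v$ of $M'(H)$, one for each $v\in V(H)$, such that $v_1\in V(C_v)$ for all $v\in V(H)$ and for each edge $uv\in E(H)$ there is an edge of $M'(H)$ joining $C_u$ and $C_v$. *)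

(* Defs.v *)
From mathcomp Require Import all_boot.

Set Implicit Arguments.
Unset Strict Implicit.
Unset Printing Implicit Defensive.

Record sgraph := SGraph {
  vertex :> finType;
  adj : rel vertex;
  adj_sym : symmetric adj;
  adj_irrefl : irreflexive adj }.

Definition triangle_free (G : sgraph) : Prop :=
  forall u v w : G, ~ [/\ adj u v, adj v w & adj u w].

Record subgraph (G : sgraph) := Subgraph {
  sub_vertices : {set G};
  sub_adj : rel G;
  sub_adj_sym : symmetric sub_adj;
  sub_adj_sub : forall x y, sub_adj x y ->
    [/\ x \in sub_vertices, y \in sub_vertices & adj x y] }.

Definition sub_connected (G : sgraph) (C : subgraph G) : Prop :=
  sub_vertices C != set0 /\
  {in sub_vertices C &, forall x y, connect (sub_adj C) x y}.

Definition rooted_minor (H G : sgraph) (root : H -> G) : Prop :=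
  exists C : H -> subgraph G,
    [/\ forall v, sub_connected (C v),
        forall u v, u != v -> [disjoint sub_vertices (C u) & sub_vertices (C v)],
        forall v, root v \in sub_vertices (C v)
      & forall u v, adj u v -> exists a b,
          [/\ a \in sub_vertices (C u), b \in sub_vertices (C v) & adj a b]].

Section MPrime.
Variable H : sgraph.

(* The pair (v, false) is v_1 and the pair (v, true) is v_2. *)
Definition mprime_adj : rel (H * bool) :=
  fun a b => adj a.1 b.1 && (a.2 || b.2).

Lemma mprime_adj_sym : symmetric mprime_adj.
Proof. by move=> a b; rewrite /mprime_adj adj_sym orbC. Qed.

Lemma mprime_adj_irrefl : irreflexive mprime_adj.
Proof. by move=> a; rewrite /mprime_adj adj_irrefl. Qed.

Definition mprime : sgraph := SGraph mprime_adj_sym mprime_adj_irrefl.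

Definition mprime_contractible : Prop :=
  @rooted_minor H mprime (fun v => (v, false)).

End MPrime.

Section Theta.
Variables k l m : nat.

Definition theta_len (j : 'I_3) : nat := tnth [tuple k; l; m] j.

(* inl false is x, inl true is y, and inr (Tagged _ i) with tag j is the i-th
   internal vertex, counted from x, of the j-th path. *)
Definition theta_vertex : finType := (bool + {j : 'I_3 & 'I_(theta_len j)})%type.

(* The position of v along the j-th path, from x at 0 to y at theta_len j + 1;
   None if v is not on this path. *)
Definition theta_pos (j : 'I_3) (v : theta_vertex) : option nat :=
  match v with
  | inl b => Some (if b then (theta_len j).+1 else 0)
  | inr t => if tag t == j then Some (tagged t).+1 else None
  end.

Definition theta_adj : rel theta_vertex := fun u v =>
  [exists j, match theta_pos j u, theta_pos j v with
             | Some p, Some q => (q == p.+1) || (p == q.+1)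
             | _, _ => false
             end].

Lemma theta_adj_sym : symmetric theta_adj.
Proof.
move=> u v; apply: eq_existsb => j.
by case: (theta_pos j u) (theta_pos j v) => [p|] [q|] //; rewrite orbC.
Qed.

Lemma theta_adj_irrefl : irreflexive theta_adj.
Proof.
move=> u; apply/existsP => -[j]; case: (theta_pos j u) => // p.
by rewrite orbb eqn_leq ltnn andbF.
Qed.

Definition theta : sgraph := SGraph theta_adj_sym theta_adj_irrefl.

End Theta.

(* Main.v *)
Require Import Defs.
From mathcomp Require Import all_boot zify.

(**
In a rooted minor, C_v consists of v_1 and of copies w_2 with w in a set S_v; these
sets are disjoint, so their sizes add up to at most n = |V(H)|. If H is triangle-free,
then |S_u| + |S_v| >= 2 for every edge uv. If exactly one of the three paths has an
odd number of internal vertices, grouping consecutive vertices of each path into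
pairs (with or without the branch vertices x and y) shows that this is only possible
with |S_v| = 1 for all v. Then S_v = {f v} for an automorphism f of H that moves
every vertex to a neighbour. It swaps x and y, and following it along the odd path,
from x, shows that this path has exactly two internal vertices, a contradiction.

Conversely, a vertex cover D in which each d has a private neighbour g(d) outside D
yields a rooted minor with S_d = {d, g(d)} for d in D, and S_v empty otherwise. Such
a cover exists when all of k, l, m are even, or when at least two of them are odd.
If H has a triangle, then k, l, m are 0, 1, m up to order, and shifting the copies w_2
along the Hamiltonian cycle that avoids the edge xy works.
*)

Set Implicit Arguments.
Unset Strict Implicit.
Unset Printing Implicit Defensive.

(** Double counting: every [w] lies in at most one of the sets. *)
Lemma sum_card_disjoint (I T : finType) (S : I -> {set T}) :
  (forall u v, u != v -> [disjoint S u & S v]) -> \sum_u #|S u| <= #|T|.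
Proof.
move=> dis; have -> : \sum_u #|S u| = \sum_w \sum_u (w \in S u).
  rewrite exchange_big; apply: eq_bigr => u _.
  by rewrite -sum1_card big_mkcond; apply: eq_bigr => w _; case: (_ \in _).
rewrite -sum1_card; apply: leq_sum => w _.
have [u wu|none] := pickP (fun u => w \in S u); last first.
  by rewrite big1 // => u _; rewrite none.
rewrite (bigD1 u) //= big1 => [|v vu]; first by case: (_ \in _).
by rewrite (disjointFl (dis _ _ vu)).
Qed.

(** * Rooted minors of [M'(H)] as families of vertex sets *)

Section Contractibility.
Variable H : sgraph.

(* [S v] is the set of the vertices [w] such that [w_2] lies in [C_v]; then [C_v]
   consists of [v_1] and these [w_2], as every other [w_1] is a root. [linked S u v]
   says that some edge of M'(H) joins [C_u] and [C_v]. *)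
Definition linked (S : H -> {set H}) (u v : H) : Prop :=
  [\/ exists2 w, w \in S u & adj w v, exists2 w, w \in S v & adj w u |
      exists w z, [/\ w \in S u, z \in S v & adj w z]].

Lemma linked_sym S u v : linked S u v -> linked S v u.
Proof.
case=> [E|E|[w [z [wu zv wz]]]]; [exact: Or32|exact: Or31|apply: Or33].
by exists z, w; rewrite adj_sym.
Qed.

(** By the second hypothesis, each [w_2] with [w] in [S v] reaches the root [v_1] in at most two
    steps, through [z_2]. *)
Lemma mprime_contractible_from_sets (S : H -> {set H}) :
    (forall u v, u != v -> [disjoint S u & S v]) ->
    (forall v w, w \in S v -> exists2 z, z \in S v & adj v z && ((w == z) || adj z w)) ->
    (forall u v, adj u v -> linked S u v) ->
  mprime_contractible H.
Proof.
move=> dis conn edges.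
pose B v : {set mprime H} := [set a | if a.2 then a.1 \in S v else a.1 == v].
pose E v : rel (mprime H) := fun a b => [&& a \in B v, b \in B v & adj a b].
have Esym v : symmetric (E v) by move=> a b; rewrite /E andbCA adj_sym.
have Esub v a b : E v a b -> [/\ a \in B v, b \in B v & adj a b] by case/and3P.
have rootB v : (v, false) \in B v by rewrite inE /=.
have B2 v w : w \in S v -> (w, true) \in B v by rewrite inE.
exists (fun v => Subgraph (Esym v) (@Esub v)); split=> /=.
- move=> v; split; first by apply/set0Pn; exists (v, false).
  have from_root a : a \in B v -> connect (E v) (v, false) a.
    case: a => w [] aB; last by move: aB; rewrite inE /= => /eqP ->; apply: connect0.
    have wS : w \in S v by move: aB; rewrite inE.
    have [z zS /andP[vz wz]] := conn _ _ wS.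
    have e1 : E v (v, false) (z, true) by rewrite /E rootB B2 //= /mprime_adj /= vz.
    case/orP: wz => [/eqP ->|zw]; first exact: connect1.
    apply: (connect_trans (connect1 e1)); apply: connect1.
    by rewrite /E !B2 //= /mprime_adj /= zw.
  move=> a b aB bB; apply: (@connect_trans _ _ (v, false)); last exact: from_root.
  by rewrite (sym_connect_sym (@Esym v)); exact: from_root.
- move=> u v uv; rewrite disjoint_subset; apply/subsetP => -[w []]; rewrite !inE /=.
    by move=> wu; rewrite (disjointFr (dis _ _ uv)).
  by move/eqP->.
- exact: rootB.
move=> u v uv; case: (edges _ _ uv) => [[w wu wv]|[w wv wu]|[w [z [wu zv wz]]]].
- by exists (w, true), (v, false); rewrite B2 ?rootB //= /mprime_adj /= wv.
- by exists (u, false), (w, true); rewrite B2 ?rootB //= /mprime_adj /= adj_sym wu.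
by exists (w, true), (z, true); rewrite !B2 //= /mprime_adj /= wz.
Qed.

(** [o] names the owner of a vertex outside [D], which keeps the sets disjoint. As [d_2] is not
    adjacent to [d_1], an owned neighbour has to connect them; each edge is then served by an
    endpoint in [D]. *)
Lemma mprime_contractible_from_cover (D : pred H) (o : H -> H) :
    (forall u v, adj u v -> D u || D v) ->
    (forall d, D d -> exists w, [/\ ~~ D w, adj d w & o w = d]) ->
  mprime_contractible H.
Proof.
move=> cover priv.
pose S d := [set w | D d && ((w == d) || [&& ~~ D w, o w == d & adj d w])].
apply: (@mprime_contractible_from_sets S).
- move=> u v uv; rewrite disjoint_subset; apply/subsetP => w; rewrite !inE.
  case/andP=> Du /orP[/eqP ->|/and3P[nDw /eqP ow _]].
    by rewrite (negPf uv) Du /= andbF.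
  rewrite ow (negPf uv) /= andbF orbF; apply/negP => /andP[Dv /eqP wv].
  by rewrite wv Dv in nDw.
- move=> v w; rewrite inE => /andP[Dv /orP[/eqP ->|priv_w]].
    have [z [nDz vz oz]] := priv _ Dv.
    by exists z; rewrite ?inE ?Dv ?nDz ?oz ?eqxx ?vz ?orbT //= adj_sym vz orbT.
  exists w; first by rewrite inE Dv priv_w orbT.
  by case/and3P: priv_w => _ _ ->; rewrite eqxx.
move=> u v uv; case/orP: (cover _ _ uv) => [Du|Dv].
- by apply: Or31; exists u; rewrite // inE Du eqxx.
by apply: Or32; exists v; rewrite ?inE ?Dv ?eqxx // adj_sym.
Qed.

Lemma mprime_contractible_sets :
  mprime_contractible H ->
  exists S : H -> {set H},
    [/\ forall u v, u != v -> [disjoint S u & S v],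
        forall v, S v != set0 -> exists2 z, z \in S v & adj v z
      & forall u v, adj u v -> linked S u v].
Proof.
case=> C [conn dis rootC edges].
pose S v := [set w | (w, true) \in sub_vertices (C v)].
have root_only v w : (w, false) \in sub_vertices (C v) -> w = v.
  move=> wv; apply/eqP; apply: contraT => /dis d.
  by move: (rootC w); rewrite (disjointFl d wv).
exists S; split.
- move=> u v /dis d; rewrite disjoint_subset; apply/subsetP => w.
  by rewrite !inE => wu; rewrite (disjointFr d wu).
- move=> v /set0Pn[w]; rewrite inE => wC.
  (* The first edge of a path from [v_1] ends at some [z_2], since no two vertices [u_1], [w_1] are
     adjacent. *)
  have /connectP[[|b p] /= pth Ew] := (conn v).2 _ _ (rootC v) wC; first by case: Ew.
  case/andP: pth => /(@sub_adj_sub _ (C v))[_ bC].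
  case: b bC {Ew} => z [] bC; rewrite /= /mprime_adj /= ?andbT ?andbF //.
  by exists z; rewrite ?inE.
move=> u v /edges[[a []] [[b []]]]; rewrite /= /mprime_adj /= ?andbT ?andbF.
- by case=> au bv ab; apply: Or33; exists a, b; rewrite !inE.
- by case=> au /root_only -> av; apply: Or31; exists a; rewrite ?inE.
- by case=> /root_only -> bv ub; apply: Or32; exists b; rewrite ?inE // adj_sym.
by case.
Qed.

(** * Set families of rooted minors in triangle-free graphs *)

Section TriangleFree.
Variable S : H -> {set H}.
Hypothesis tf : triangle_free H.
Hypothesis attach : forall v, S v != set0 -> exists2 z, z \in S v & adj v z.
Hypothesis edges : forall u v, adj u v -> linked S u v.

Lemma singleton_set_adj v w : S v = [set w] -> adj v w.
Proof.
move=> Sv; have [|z] := attach (v := v); last by rewrite Sv inE => /eqP ->.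
by apply/set0Pn; exists w; rewrite Sv inE.
Qed.

Lemma singleton_set_nonadj u v w : adj u v -> S u = [set w] -> ~~ adj w v.
Proof.
move=> uv Su; apply/negP => wv; apply: (tf (u := u) (v := w) (w := v)).
by split=> //; apply: singleton_set_adj.
Qed.

(** If [S x] is empty and [S y] has at most one element, the link can only come from some [z] in
    [S y] adjacent to [x]; as [z] is also adjacent to [y], this closes a triangle. *)
Lemma card_sets_adj u v : adj u v -> 2 <= #|S u| + #|S v|.
Proof.
have main x y : adj x y -> S x = set0 -> #|S y| <= 1 -> False.
  move=> xy Sx; case: (posnP #|S y|) => [/eqP|Sy0 Sy1].
    rewrite cards_eq0 => /eqP Sy _.
    by case: (edges xy) => [[w]|[w]|[w [z []]]]; rewrite ?Sx ?Sy inE.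
  have /eqP/cards1P[z Sy] : #|S y| = 1 by lia.
  case: (edges xy) => [[w]|[w]|[w [? []]]]; rewrite ?Sx ?inE // Sy inE => /eqP -> zx.
  by rewrite adj_sym in xy; case/negP: (singleton_set_nonadj xy Sy).
move=> uv; rewrite leqNgt; apply/negP => lt2.
case: (posnP #|S u|) => [/eqP|Su]; rewrite ?cards_eq0.
  by move/eqP => Su; apply: (main u v) => //; rewrite Su cards0 in lt2; lia.
have /eqP : #|S v| = 0 by lia.
rewrite cards_eq0 => /eqP Sv; rewrite adj_sym in uv.
by apply: (main v u) => //; lia.
Qed.

(** A link that uses the root of [u] or of [v] would close a triangle, so the link joins [f u] to
    [f v]. *)
Lemma singleton_sets_endo (f : H -> H) :
  (forall v, S v = [set f v]) -> forall u v, adj u v -> adj (f u) (f v).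
Proof.
move=> Sf u v uv; case: (edges uv) => [[w]|[w]|[w [z []]]]; rewrite !Sf !inE.
- by move/eqP->; rewrite (negPf (singleton_set_nonadj uv (Sf u))).
- rewrite adj_sym in uv.
  by move/eqP->; rewrite (negPf (singleton_set_nonadj uv (Sf v))).
by move=> /eqP -> /eqP ->.
Qed.

End TriangleFree.

End Contractibility.

(** * Vertex weights along a path *)

Section PathWeights.
Variable q : nat -> nat.

Lemma sum_nat_pairs r n :
  (forall p, r <= p -> p.+1 < r + n.*2 -> 2 <= q p + q p.+1) ->
  n.*2 <= \sum_(r <= p < r + n.*2) q p.
Proof.
elim: n => [|n IHn] ge2; first by [].
rewrite doubleS !addnS !big_nat_recr ?leq_addr //=; last by lia.
have := ge2 (r + n.*2); have : n.*2 <= \sum_(r <= p < r + n.*2) q p.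
  by apply: IHn => p *; apply: ge2; lia.
lia.
Qed.

Lemma sum_nat_pairs_even r s :
    r <= s -> ~~ odd (s - r) ->
    (forall p, r <= p -> p.+1 < s -> 2 <= q p + q p.+1) ->
  s - r <= \sum_(r <= p < s) q p.
Proof.
move=> rs ev ge2; have e : s = r + (s - r)./2.*2 by lia.
have := @sum_nat_pairs r (s - r)./2; rewrite -e => /(_ ge2); lia.
Qed.

(** Summing [q p + q p.+1] over all [p <= L] counts the two end weights once and the others twice,
    [2 * L.+1] in all. So every pair sums to exactly 2, and the value 1 propagates from [q 0]. *)
Lemma tight_path_weights L :
    (forall p, p <= L -> 2 <= q p + q p.+1) ->
    q 0 = 1 -> q L.+1 = 1 -> \sum_(1 <= p < L.+1) q p = L ->
  forall p, p <= L.+1 -> q p = 1.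
Proof.
move=> ge2 q0 qL; rewrite big_add1 /= => sumL.
have tight p : p <= L -> q p + q p.+1 = 2.
  move=> pL.
  have leq_i (i : 'I_L.+1) : true -> 2 <= q i + q i.+1 ?= iff (q i + q i.+1 == 2).
    by move=> _; split; [apply: ge2; have := ltn_ord i; lia | rewrite eq_sym].
  have /leqif_sum[_] := leq_i.
  rewrite sum_nat_const card_ord big_split /= -(big_mkord xpredT q) -(big_mkord xpredT (q \o succn)) /=.
  have -> : \sum_(0 <= i < L.+1) q i = L.+1 by rewrite big_nat_recl // q0 sumL.
  have -> : \sum_(0 <= i < L.+1) q i.+1 = L.+1.
    by rewrite big_nat_recr //= qL sumL addn1.
  have -> : L.+1 * 2 == L.+1 + L.+1 by lia.
  move/esym/forallP => /(_ (Ordinal (pL : p < L.+1))) /eqP //.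
elim=> [//|p IHp] lt_p; have := tight p; have := IHp; lia.
Qed.
End PathWeights.

(** * Coordinates on theta graphs *)

Section Theta.
Variables k l m : nat.
Notation len := (theta_len k l m).
Notation theta := (theta k l m).

(** Inverts [theta_pos j]; every position past [len j] is read as [y]. *)
Definition path_vertex (j : 'I_3) (p : nat) : theta :=
  if p is p'.+1 then
    if insub p' is Some i then inr (Tagged (fun j => 'I_(len j)) (i : 'I_(len j)))
    else inl true
  else inl false.

Notation pv := path_vertex.

Lemma path_vertex_end j p : len j < p -> path_vertex j p = inl true.
Proof. by case: p => //= p lt_p; rewrite insubN // -leqNgt. Qed.

Lemma path_vertex_ord j (i : 'I_(len j)) :
  path_vertex j i.+1 = inr (Tagged (fun j => 'I_(len j)) i).
Proof. by rewrite /path_vertex /= valK. Qed.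

Lemma path_vertex_int j p : 0 < p <= len j ->
  exists2 i : 'I_(len j), p = i.+1 &
    path_vertex j p = inr (Tagged (fun j => 'I_(len j)) i).
Proof.
case: p => // p /= lt_p; exists (Ordinal lt_p) => //.
by rewrite -path_vertex_ord.
Qed.

Lemma theta_pos_path_vertex j p :
  theta_pos j (path_vertex j p) = Some (minn p (len j).+1).
Proof.
case: p => [|p]; first by rewrite min0n.
have [lt_p|ge_p] := ltnP p (len j); last first.
  by rewrite path_vertex_end //= (minn_idPr _).
have [i -> ->] := @path_vertex_int j p.+1 lt_p.
by rewrite /= eqxx (minn_idPl _) // ltnS; apply: ltnW.
Qed.

Lemma theta_posK j (v : theta) p :
  theta_pos j v = Some p -> p <= (len j).+1 /\ v = path_vertex j p.
Proof.
case: v => [[] [<-]|[j' i]] //; first by rewrite path_vertex_end.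
rewrite /=; case: eqP => // ej; subst j' => -[<-].
by rewrite path_vertex_ord ltnS ltnW.
Qed.

Lemma path_vertex_inj j p p' : p <= (len j).+1 -> p' <= (len j).+1 ->
  path_vertex j p = path_vertex j p' -> p = p'.
Proof.
move=> le_p le_p' /(congr1 (theta_pos j)); rewrite !theta_pos_path_vertex => -[]; lia.
Qed.

Lemma path_vertex_inrE j p (t : {j : 'I_3 & 'I_(len j)}) :
  path_vertex j p = inr t -> tag t = j /\ p = (tagged t).+1.
Proof.
case: p => //= p; case: insubP => // i _ <- [<-] //.
Qed.

Lemma theta_adjP (u v : theta) :
  reflect (exists j p, p <= len j /\
             ((u = path_vertex j p /\ v = path_vertex j p.+1) \/
              (v = path_vertex j p /\ u = path_vertex j p.+1)))
          (adj u v).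
Proof.
apply: (iffP existsP) => [[j]|[j [p [le_p uv]]]].
  case Eu: (theta_pos j u) => [p|] //; case Ev: (theta_pos j v) => [p'|] //.
  have [le_p ->] := theta_posK Eu; have [le_p' ->] := theta_posK Ev.
  by case/orP => /eqP E; subst; exists j; eexists; split; [|auto| |auto]; lia.
exists j; case: uv => -[-> ->]; rewrite !theta_pos_path_vertex; lia.
Qed.

Lemma adj_path_vertex j p : p <= len j -> adj (path_vertex j p) (path_vertex j p.+1).
Proof. by move=> le_p; apply/theta_adjP; exists j, p; auto. Qed.

Lemma adj_path_vertexr j p : p <= len j -> adj (path_vertex j p.+1) (path_vertex j p).
Proof. by move=> le_p; rewrite adj_sym adj_path_vertex. Qed.

(** Index [i] stands at position [i + 1], so the two neighbours have positions [i] and [i + 2]. *)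
Lemma adj_internal (t : {j : 'I_3 & 'I_(len j)}) (v : theta) :
  adj (inr t : theta) v ->
  v = path_vertex (tag t) (tagged t) \/ v = path_vertex (tag t) (tagged t).+2.
Proof.
case/theta_adjP=> j [p [le_p [[/esym/path_vertex_inrE[<- ->] ->]|]]]; first by right.
by case=> -> /esym/path_vertex_inrE[<- [->]]; left.
Qed.

Lemma theta_vertexP (v : theta) :
  [\/ v = inl false, v = inl true | exists j p, 0 < p <= len j /\ v = path_vertex j p].
Proof.
case: v => [[]|[j i]]; [exact: Or32|exact: Or31|apply: Or33].
by exists j, i.+1; rewrite path_vertex_ord ltn_ord.
Qed.

Lemma sum_theta (F : theta -> nat) :
  \sum_v F v = F (inl false) + F (inl true) +
    \sum_j \sum_(1 <= p < (len j).+1) F (path_vertex j p).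
Proof.
rewrite big_sumType /= big_bool /= [F _ + F _]addnC; congr (_ + _).
transitivity (\sum_j \sum_(i < len j) F (inr (Tagged (fun j => 'I_(len j)) i))).
  by rewrite sig_big_dep /=; apply: eq_bigr => -[j i].
apply: eq_bigr => j _; rewrite big_add1 succnK big_mkord.
by apply: eq_bigr => i _; rewrite path_vertex_ord.
Qed.

Lemma card_theta : #|theta| = 2 + \sum_j len j.
Proof.
rewrite -sum1_card sum_theta; congr (_ + _).
by apply: eq_bigr => j _; rewrite sum_nat_const_nat muln1 subn1.
Qed.

Local Arguments path_vertex : simpl never.

Lemma count_theta_len (P : pred nat) :
  count P [:: k; l; m] = #|[set j | P (len j)]|.
Proof.
rewrite -sum1_card big_mkcond /= !big_ord_recl big_ord0 /= !inE.
rewrite /theta_len !(tnth_nth 0) /=.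
by case: (P k) (P l) (P m) => [] [] [].
Qed.

(** * Non-contractibility: endomorphisms and weights of theta graphs *)

Hypothesis zero_uniq : forall i j, len i = 0 -> len j = 0 -> i = j.

(** Internal vertices of different paths differ, and only an empty path leads from [x] directly to
    [y]. *)
Lemma path_vertex_second_inj : injective (pv^~ 1).
Proof.
move=> i j /=; have [i0|i0] := posnP (len i); have [j0|j0] := posnP (len j).
- by move=> _; apply: zero_uniq.
- have [t _ ->] := @path_vertex_int j 1 j0.
  by rewrite path_vertex_end ?i0.
- have [t _ ->] := @path_vertex_int i 1 i0.
  by rewrite path_vertex_end ?j0.
have [t _ ->] := @path_vertex_int i 1 i0.
by case/esym/path_vertex_inrE.
Qed.

Lemma path_vertex_penultimate_inj : injective (fun j => pv j (len j)).
Proof.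
move=> i j /=; have [i0|i0] := posnP (len i); have [j0|j0] := posnP (len j).
- by move=> _; apply: zero_uniq.
- have [|t _ ->] := @path_vertex_int j (len j); first by rewrite j0 leqnn.
  by rewrite i0.
- have [|t _ ->] := @path_vertex_int i (len i); first by rewrite i0 leqnn.
  by rewrite j0.
have [|t _ ->] := @path_vertex_int i (len i); first by rewrite i0 leqnn.
by case/esym/path_vertex_inrE.
Qed.

(** The three neighbours of [u] have three distinct images adjacent to [f u], while an internal
    vertex has only two neighbours. *)
Lemma injective_endo_branch (f : theta -> theta) (u : theta) (nb : 'I_3 -> theta) :
    injective f -> (forall v w, adj v w -> adj (f v) (f w)) ->
    injective nb -> (forall j, adj u (nb j)) ->
  exists b, f u = inl b.
Proof.
move=> finj fhom nbinj unb; case Efu: (f u) => [b|t]; first by exists b.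
have sub : [set (f \o nb) j | j : 'I_3] \subset [set pv (tag t) (tagged t); pv (tag t) (tagged t).+2].
  apply/subsetP => _ /imsetP[j _ ->]; rewrite !inE.
  have := fhom _ _ (unb j); rewrite Efu.
  by case/adj_internal => /= ->; rewrite eqxx ?orbT.
have := subset_leq_card sub.
rewrite card_imset ?cards2 ?card_ord; last by move=> i j /finj/nbinj.
by case: (_ == _).
Qed.

Lemma no_shift_endo (f : theta -> theta) j0 :
    injective f -> (forall v, adj v (f v)) ->
    (forall v w, adj v w -> adj (f v) (f w)) -> odd (len j0) -> False.
Proof.
move=> finj fadj fhom oddj.
have fx : f (inl false) = inl true.
  have [j|[] //] := injective_endo_branch (u := inl false) finj fhom path_vertex_second_inj.
    exact: (@adj_path_vertex j 0).
  by move=> E; have := fadj (inl false); rewrite E adj_irrefl.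
have fy : f (inl true) = inl false.
  have [j|[] //] := injective_endo_branch (u := inl true) finj fhom path_vertex_penultimate_inj.
    by rewrite -(@path_vertex_end j (len j).+1) // adj_path_vertexr.
  by move=> E; have := fadj (inl true); rewrite E adj_irrefl.
have len_gt0 : 0 < len j0 by lia.
have [t tE p1E] := @path_vertex_int j0 1 len_gt0.
(* The other neighbour, [x], is already the image of [y]. *)
have fp1 : f (pv j0 1) = pv j0 2.
  have := fadj (pv j0 1); rewrite {1}p1E => /adj_internal /= [|]; case: tE => <- //.
  by rewrite -[RHS]fy => /finj; rewrite p1E.
(* Otherwise position 2 is [y], already the image of [x]. *)
have len_gt1 : 1 < len j0.
  rewrite ltnNge; apply/negP => len_le1.
  by move: fp1; rewrite (@path_vertex_end _ 2) // -fx => /finj; rewrite p1E.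
have [t' t'E p2E] := @path_vertex_int j0 2 len_gt1.
(* The edge between [x] and position 1 is mapped to an edge between [y] and position 2, so [y] sits
   at position 3 and [len j0 = 2], which is not odd. *)
have := fhom _ _ (@adj_path_vertexr j0 0 isT).
rewrite fp1 fx p2E => /adj_internal /=; case: t'E => <-; rewrite p1E => -[//|].
have [len2|len_gt2] := eqVneq (len j0) 2; first by rewrite len2 in oddj.
by have [|t'' _ ->] := @path_vertex_int j0 3; first by lia.
Qed.

Lemma path_weights_all_one (s : theta -> nat) j0 :
    (forall u v, adj u v -> 2 <= s u + s v) -> \sum_v s v <= #|theta| ->
    odd (len j0) -> (forall j, j != j0 -> ~~ odd (len j)) ->
  forall v, s v = 1.
Proof.
move=> ge2 le_sum odd0 even.
have ge2p j p : p <= len j -> 2 <= s (pv j p) + s (pv j p.+1).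
  by move=> le_p; apply: ge2; apply: adj_path_vertex.
have x0 j : s (pv j 0) = s (inl false) by [].
have y0 j : s (pv j (len j).+1) = s (inl true) by rewrite path_vertex_end.
pose W j := \sum_(1 <= p < (len j).+1) s (pv j p).
have Wx j : \sum_(0 <= p < (len j).+1) s (pv j p) = s (inl false) + W j.
  by rewrite big_ltn.
have Wy j : \sum_(1 <= p < (len j).+2) s (pv j p) = W j + s (inl true).
  by rewrite big_nat_recr //= y0.
have Wxy j : \sum_(0 <= p < (len j).+2) s (pv j p) = s (inl false) + W j + s (inl true).
  by rewrite big_nat_recr //= y0 Wx.
have pairs j r t : r <= t <= (len j).+2 -> ~~ odd (t - r) ->
    t - r <= \sum_(r <= p < t) s (pv j p).
  case/andP=> rt tL ev; apply: (@sum_nat_pairs_even (fun p => s (pv j p))) => // p _ pt.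
  by apply: ge2p; lia.
(* Even paths are paired up without or with both branch vertices, the odd path with exactly one of
   them. *)
have evW j : j != j0 -> len j <= W j /\ len j + 2 <= s (inl false) + W j + s (inl true).
  move=> /even ev; have := pairs j 1 (len j).+1; have := pairs j 0 (len j).+2.
  rewrite Wxy -/(W j); lia.
have odW : (len j0).+1 <= s (inl false) + W j0 /\ (len j0).+1 <= W j0 + s (inl true).
  have := pairs j0 0 (len j0).+1; have := pairs j0 1 (len j0).+2.
  rewrite Wx Wy; lia.
have total : s (inl false) + s (inl true) + \sum_j W j <= 2 + \sum_j len j.
  by rewrite -card_theta -sum_theta.
rewrite (bigD1 j0) //= [in leqRHS](bigD1 j0) //= in total.
have leW : \sum_(j | j != j0) len j <= \sum_(j | j != j0) W j ?= iff
    [forall (j | j != j0), len j == W j].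
  by apply: leqif_sum => j /evW[leW _]; split.
have leW2 : \sum_(j | j != j0) (len j + 2) <=
    \sum_(j | j != j0) (W j + (s (inl false) + s (inl true))).
  by apply: leq_sum => j /evW[_]; lia.
rewrite !big_split /= !sum_nat_const cardC1 card_ord in leW2.
have [leW1 eqW] := leW.
(* Let [d], [w], [e] be the excesses of [s x + s y] over 2, of [W j0] over [len j0], and of the
   total [W] of the two even paths over their total length. Then [e >= 0], [d + 2w >= 0],
   [e + 2d >= 0] and [d + w + e <= 0], which forces all three to vanish. *)
have [sx [sy [W0 eqA]]] : s (inl false) = 1 /\ s (inl true) = 1 /\ W j0 = len j0 /\
    \sum_(j | j != j0) len j = \sum_(j | j != j0) W j.
  move: leW1 leW2 total odW; rewrite /= -!/(W _).
  move: (\sum_(j | _) len j) (\sum_(j | _) W j) (W j0) => A B W0; lia.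
have WE j : W j = len j.
  have [->|ne] := eqVneq j j0; first exact: W0.
  move: eqW; rewrite eqA eqxx.
  by move/esym/forall_inP => /(_ _ ne)/eqP.
move=> v; have [->|->|[j [p [lt_p ->]]]] := theta_vertexP v => //.
apply: (@tight_path_weights (fun p => s (pv j p)) (len j)) => //; try lia.
- by move=> p' ?; apply: ge2p.
- by rewrite path_vertex_end.
- exact: WE.
Qed.

Lemma theta_not_contractible :
  count odd [:: k; l; m] = 1 -> triangle_free theta -> ~ mprime_contractible theta.
Proof.
rewrite count_theta_len => /eqP/cards1P[j0 oddE] tf /mprime_contractible_sets[S [dis attach edges]].
have oddP j : odd (len j) = (j == j0) by move/setP/(_ j): oddE; rewrite !inE.
have ge2 := card_sets_adj tf attach edges.
have card1 v : #|S v| = 1.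
  apply: (path_weights_all_one (j0 := j0) ge2); first exact: sum_card_disjoint.
    by rewrite oddP.
  by move=> j; rewrite oddP.
have /fin_all_exists[f Sf] v : exists w, S v = [set w] by apply/cards1P/eqP.
apply: (@no_shift_endo f j0); last by rewrite oddP.
- move=> u v fuv; apply/eqP; apply: contraT => /dis.
  by rewrite !Sf fuv -setI_eq0 setIid => /eqP/setP/(_ (f v)); rewrite !inE eqxx.
- by move=> v; apply: singleton_set_adj (Sf v).
exact: singleton_sets_endo Sf.
Qed.

(** * Contractible theta graphs *)

(* The cover consists of [x], the even positions, and [y] when [with_y]; on the
   path [j0] every cover vertex is matched forward, on the others backward. *)
Lemma theta_contractible_parity (j0 : 'I_3) (with_y : bool) :
    0 < len j0 ->
    (if with_y then odd (len j0) /\ exists2 j1, j1 != j0 & odd (len j1)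
     else forall j, ~~ odd (len j)) ->
  mprime_contractible theta.
Proof.
move=> j0_gt0 par.
pose D (v : theta) := match v with inl b => b ==> with_y | inr t => odd (tagged t) end.
pose o (v : theta) : theta := match v with
  | inl _ => pv j0 (len j0)
  | inr t => if tag t == j0 then pv (tag t) (tagged t) else pv (tag t) (tagged t).+2
  end.
have Dint j p : 0 < p <= len j -> D (pv j p) = ~~ odd p.
  by move=> /path_vertex_int[i -> ->]; rewrite /= negbK.
have oint j p : 0 < p <= len j -> o (pv j p) = if j == j0 then pv j p.-1 else pv j p.+1.
  by move=> /path_vertex_int[i -> ->].
have Dy j : D (pv j (len j).+1) = with_y by rewrite path_vertex_end.
apply: (@mprime_contractible_from_cover _ D o).
  suff cov j p : p <= len j -> D (pv j p) || D (pv j p.+1).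
    move=> u v /theta_adjP[j [p [le_p [[-> ->]|[-> ->]]]]]; first exact: cov.
    by rewrite orbC; apply: cov.
  case: p => // p lt_p; rewrite Dint //=.
  (* Alternating parity settles every edge but the last one, into [y]: there either [y] is in [D] or
     [len j] is even. *)
  move: lt_p; rewrite leq_eqVlt => /orP[/eqP E|lt_p]; last first.
    by rewrite Dint // /=; case: (odd p).
  rewrite [in X in _ || X]E Dy; case: with_y par {D o Dint oint Dy} => [|/(_ j)]; rewrite ?orbT //.
  by rewrite -E /= => ->.
move=> d Dd; have [dE|dE|[j [p [lt_p dE]]]] := theta_vertexP d.
- exists (pv j0 1); rewrite Dint ?oint //= eqxx dE; split=> //.
  exact: (@adj_path_vertex j0 0).
- move: Dd; rewrite dE /= => wy; rewrite wy in par.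
  have [odd0 [j1 ne odd1]] := par.
  have j1_gt0 : 0 < len j1 <= len j1 by lia.
  (* The last internal vertex of path [j1] has odd position, hence is outside [D], and its owner is
     the next vertex, [y]. *)
  exists (pv j1 (len j1)); rewrite Dint ?oint // odd1 (negPf ne) (@path_vertex_end j1 (len j1).+1) //.
  split=> //; rewrite -(@path_vertex_end j1 (len j1).+1) //.
  exact: adj_path_vertexr.
move: Dd; rewrite {d}dE Dint // => evp.
have [ej|ne] := eqVneq j j0; last first.
  exists (pv j p.-1); case: p lt_p evp => // -[//|p] lt_p evp /=.
  have lt_p' : 0 < p.+1 <= len j by lia.
  rewrite Dint ?oint // (negPf ne); split=> //; apply: adj_path_vertexr; lia.
subst j; exists (pv j0 p.+1); case/andP: lt_p => p_gt0.
rewrite leq_eqVlt => /orP[/eqP pE|lt_p]; last first.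
  by rewrite Dint ?oint ?eqxx //; split; [rewrite /= evp | apply/adj_path_vertex/ltnW |].
(* Here [len j0] is even, so [y] is outside [D] and is the private neighbour of the last internal
   vertex. *)
rewrite pE Dy adj_path_vertex // path_vertex_end //; split=> //.
by case: with_y par {D o Dint oint Dy} => // -[odd0 _]; rewrite pE odd0 in evp.
Qed.

(* The sets are singletons shifted along the Hamiltonian cycle through paths [j1]
   and [j2]; the chord [xy] is served by the middle vertex of path [j1]. *)
Lemma theta_contractible_triangle (j0 j1 j2 : 'I_3) :
    len j0 = 0 -> len j1 = 1 -> (forall j, [|| j == j0, j == j1 | j == j2]) ->
    j2 != j1 -> 0 < len j2 ->
  mprime_contractible theta.
Proof.
move=> len0 len1 cover3 ne21 len2.
have [|a aE pvaE] := @path_vertex_int j1 1; first by rewrite len1.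
(* One step along the cycle: from [x] through path [j2] to [y], then back through path [j1]. The
   copy [w_2] goes to the branch set of [o w]. *)
pose o (v : theta) : theta := match v with
  | inl b => if b then pv j1 1 else pv j2 1
  | inr t => if tag t == j1 then inl false else pv (tag t) (tagged t).+2
  end.
have ox : o (inl false) = pv j2 1 by [].
have oy : o (inl true) = pv j1 1 by [].
have oa : o (pv j1 1) = inl false by rewrite pvaE /= eqxx.
have o2 p : p <= len j2 -> o (pv j2 p) = pv j2 p.+1.
  case: p => [//|p] lt_p; have [i -> ->] := @path_vertex_int j2 p.+1 lt_p.
  by rewrite /= (negPf ne21).
have xa : adj (inl false : theta) (pv j1 1) by apply: (@adj_path_vertex j1 0).
have ay : adj (pv j1 1) (inl true : theta).
  by rewrite -(@path_vertex_end j1 2) ?len1 //; apply: adj_path_vertex; rewrite len1.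
pose S v := [set w | (o w == v) && adj v w].
have oadj w : adj (o w) w.
  have [->|->|[j [p [lt_p ->]]]] := theta_vertexP w.
  - rewrite ox; exact: (@adj_path_vertexr j2 0).
  - by rewrite oy.
  case/or3P: (cover3 j) lt_p => /eqP ->; rewrite ?len0 ?len1; first lia.
    by case: p => [|[|p]] // _; rewrite oa.
  by move=> lt_p; rewrite o2 ?adj_path_vertexr; lia.
have SE v w : (w \in S v) = (o w == v).
  by rewrite inE; case: eqP => [<-|//]; rewrite oadj.
apply: (@mprime_contractible_from_sets _ S).
- move=> u v uv; rewrite disjoint_subset; apply/subsetP => w; rewrite !inE.
  by case/andP=> /eqP -> _; rewrite (negPf uv).
- by move=> v w; rewrite SE => /eqP ow; exists w; rewrite ?SE ?eqxx -?ow ?oadj.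
suff base j p : p <= len j -> linked S (pv j p) (pv j p.+1).
  move=> u v /theta_adjP[j [p [le_p [[-> ->]|[-> ->]]]]]; first exact: base.
  by apply: linked_sym; apply: base.
(* Each cycle edge is linked by the edge one step back along the cycle. *)
case/or3P: (cover3 j) => /eqP ->.
- rewrite len0; case: p => // _; rewrite (@path_vertex_end _ 1) ?len0 //; apply: Or31.
  by exists (pv j1 1); rewrite ?SE ?oa.
- rewrite len1; case: p => [|[|//]] _.
    by apply: Or33; exists (pv j1 1), (inl true); rewrite !SE oa oy eqxx.
  rewrite (@path_vertex_end _ 2) ?len1 //; apply: Or33.
  exists (inl true), (pv j2 (len j2)); rewrite !SE oy o2 // (@path_vertex_end j2 (len j2).+1) //; split=> //.
  by rewrite -(@path_vertex_end j2 (len j2).+1) // adj_path_vertexr.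
case: p => [_|p lt_p]; apply: Or33.
  by exists (pv j1 1), (inl false); rewrite !SE oa ox eqxx adj_sym.
exists (pv j2 p), (pv j2 p.+1); rewrite !SE !o2 ?eqxx ?adj_path_vertex //; lia.
Qed.

(** With only two branch vertices, a triangle has an internal vertex. Its neighbours, two positions
    apart on its path, are adjacent only if they are [x] and [y]: that path has length 1 and another
    one is empty. *)
Lemma theta_triangle_len (u v w : theta) :
  adj u v -> adj v w -> adj u w -> exists j0 j1, len j0 = 0 /\ len j1 = 1.
Proof.
have xy_len0 b : adj (inl b : theta) (inl (~~ b)) -> exists j0, len j0 = 0.
  have both j p b1 b2 : p <= len j -> inl b1 = pv j p -> inl b2 = pv j p.+1 -> len j = 0.
    case: p => [_ _|p lt_p]; last by have [i _ ->] := @path_vertex_int j p.+1 lt_p.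
    by case: (posnP (len j)) => // /(@path_vertex_int j 1)[i _ ->].
  by case/theta_adjP=> j [p [le_p [[E1 E2]|[E1 E2]]]]; exists j; apply: both le_p E1 E2.
have internal (t : {j : 'I_3 & 'I_(len j)}) v1 v2 :
    adj (inr t : theta) v1 -> adj (inr t : theta) v2 -> adj v1 v2 ->
    exists j0 j1, len j0 = 0 /\ len j1 = 1.
  have gap j p : p < len j -> adj (pv j p) (pv j p.+2) ->
      exists j0 j1, len j0 = 0 /\ len j1 = 1.
    case: p => [|p] lt_p.
      have [len_gt1|len_le1] := ltnP 1 (len j).
        have [i iE ->] := @path_vertex_int j 2 len_gt1.
        rewrite adj_sym => /adj_internal /=; case: iE => <-.
        by case=> /path_vertex_inj-/(_ isT); lia.
      rewrite [pv j 2]path_vertex_end // => /(xy_len0 false)[j0 len0].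
      by exists j0, j; split=> //; lia.
    have [i iE ->] := @path_vertex_int j p.+1 (ltnW lt_p).
    by move=> /adj_internal /=; case: iE => <-; case=> /path_vertex_inj; lia.
  have lt_t := ltn_ord (tagged t).
  case/adj_internal=> ->; case/adj_internal=> ->; rewrite ?adj_irrefl //.
    exact: gap.
  by move=> h; apply: (gap _ _ lt_t); rewrite adj_sym.
move=> uv vw uw.
case: u uv uw => [b1|t] uv uw; last exact: (internal t v w).
case: v uv vw => [b2|t] uv vw; last by apply: (internal t (inl b1) w); rewrite // adj_sym.
case: w uw vw => [b3|t] uw vw; last by apply: (internal t (inl b1) (inl b2)); rewrite // adj_sym.
have ne b b' : adj (inl b : theta) (inl b') -> b != b'.
  by move=> bb; apply/negP => /eqP E; rewrite E adj_irrefl in bb.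
by move: (ne _ _ uv) (ne _ _ vw) (ne _ _ uw); case: b1 b2 b3 {uv vw uw} => [] [] [].
Qed.
End Theta.

Theorem theorem7p10 (k l m : nat)
    (at_most_one_zero : count (pred1 0) [:: k; l; m] <= 1) :
  ~ mprime_contractible (theta k l m) <->
  count odd [:: k; l; m] = 1 /\ triangle_free (theta k l m).
Proof.
have zero_uniq i j : theta_len k l m i = 0 -> theta_len k l m j = 0 -> i = j.
  rewrite count_theta_len in at_most_one_zero; move/card_le1_eqP: at_most_one_zero => uniq0.
  by move=> i0 j0; apply: uniq0; rewrite inE /= ?i0 ?j0.
split=> [noncontr|[]]; last exact: theta_not_contractible.
split.
  apply/eqP; apply: contraT => odd_ne1; case: noncontr.
  rewrite count_theta_len in odd_ne1.
  (* At least two odd paths give a cover with [y], no odd path one without [y]. *)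
  have [/card_gt1P[j0 [j1 [j0P j1P ne]]]|le1] := ltnP 1 #|[set j | odd (theta_len k l m j)]|.
    rewrite !inE in j0P j1P.
    apply: (theta_contractible_parity (j0 := j0) (with_y := true)); first by case: theta_len j0P.
    by split=> //; exists j1; rewrite // eq_sym.
  have /eqP : #|[set j | odd (theta_len k l m j)]| = 0 by lia.
  rewrite cards_eq0 => /eqP/setP even.
  (* The private neighbour of [x] needs a nonempty path; at most one path is empty. *)
  have [j0 j0_gt0] : exists j0, 0 < theta_len k l m j0.
    have [z|] := posnP (theta_len k l m ord0); last by exists ord0.
    exists ord_max; rewrite lt0n; apply/eqP => /(zero_uniq _ _ z) //.
  apply: (theta_contractible_parity (j0 := j0) (with_y := false)) => // j.
  by have := even j; rewrite !inE => ->.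
move=> u v w [uv vw uw]; case: noncontr.
have [j0 [j1 [len0 len1]]] := theta_triangle_len uv vw uw.
have ne : j0 != j1 by apply/eqP => E; rewrite E len1 in len0.
have /cards1P[j2 E] : #|~: [set j0; j1]| == 1.
  by rewrite cardsCs setCK card_ord cards2 ne.
have other j : (j == j2) = ~~ ((j == j0) || (j == j1)).
  by move/setP/(_ j): E; rewrite !inE.
have := other j2; rewrite eqxx => /esym; rewrite negb_or => /andP[ne20 ne21].
apply: (theta_contractible_triangle len0 len1 (j2 := j2)) => // [j|].
  by rewrite other orbA orbN.
by rewrite lt0n; apply: contra ne20 => /eqP/zero_uniq/(_ len0)->.
Qed.
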